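(* We have the equality $\beta_{\mathrm{sep}}^{\mathbb{R}}(\mathrm{C}_3\times\mathrm{C}_3)=3$, where $\mathrm{C}_3$ is the cyclic group of order $3$.
   Context: For a finite group $G$, a field $\mathbb{F}$ and a finite dimensional representation $V$ of $G$ over $\mathbb{F}$, $\mathbb{F}[V]$ is the coordinate ring (polynomial algebra in the coordinate functions on $V$, with standard grading), with $G$-action $(g\cdot f)(v)=f(g^{-1}v)$, and $\mathbb{F}[V]^G$ is the subalgebra of polynomial invariants. $\beta_{\mathrm{sep}}(G,V)$ is the minimal positive integer $d$ such that for any $v,w\in V$ with $G\cdot v\neq G\cdot w$ there exists an $f\in\mathbb{F}[V]^G$ of degree at most $d$ with $f(v)\neq f(w)$. $\beta_{\mathrm{sep}}^{\mathbb{F}}(G)$ (the separating Noether number of $G$ over $\mathbb{F}$) is the maximum of $\beta_{\mathrm{sep}}(G,V)$ as $V$ ranges over all finite dimensional representations of $G$ over $\mathbb{F}$. *)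

(* Defs.v *)
From mathcomp Require Import all_boot all_order all_algebra all_fingroup.
From mathcomp Require Import all_character.
From mathcomp Require Import classical_sets reals.
From mathcomp Require Import mpoly.

Set Implicit Arguments.
Unset Strict Implicit.
Unset Printing Implicit Defensive.

Import GRing.Theory.
Local Open Scope ring_scope.
Local Open Scope classical_set_scope.

(* A representation of G on V = F^n is an mx_representation acting on column
   vectors by v |-> rG g *m v, which is a left action since rG is
   multiplicative. The coordinate ring F[V] is {mpoly F[n]}, where 'X_i is the
   i-th coordinate function. *)
Section SeparatingNoetherNumber.
Variables (F : fieldType) (gT : finGroupType) (G : {group gT}).

Section Representation.
Variables (n : nat) (rG : mx_representation F G n).

Definition rep_orbit (v : 'cV[F]_n) : set 'cV[F]_n :=
  [set rG g *m v | g in [set` G]].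

Definition poly_at (f : {mpoly F[n]}) (v : 'cV[F]_n) : F :=
  f.@[fun i => v i ord0].

(* (g . f)(v) = f (g^-1 v) as a formal substitution, so that it is also correct
   when F is finite. *)
Definition poly_act (g : gT) (f : {mpoly F[n]}) : {mpoly F[n]} :=
  f \mPo [tuple \sum_(j < n) rG g^-1%g i j *: 'X_j | i < n].

Lemma poly_actE g f v : poly_at (poly_act g f) v = poly_at f (rG g^-1%g *m v).
Proof.
rewrite /poly_at /poly_act comp_mpoly_meval; apply: meval_eq => i.
rewrite tnth_mktuple mxE raddf_sum; apply: eq_bigr => j _ /=.
by rewrite mevalZ mevalXU.
Qed.

Definition poly_invariant (f : {mpoly F[n]}) : Prop :=
  forall g, g \in G -> poly_act g f = f.

(* msize is the total degree plus one (and 0 for the zero polynomial). *)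
Definition separating_degree (d : nat) : Prop :=
  forall v w : 'cV[F]_n, rep_orbit v <> rep_orbit w ->
  exists f : {mpoly F[n]},
    [/\ poly_invariant f, (msize f <= d.+1)%N & poly_at f v <> poly_at f w].

Definition is_beta_sep (d : nat) : Prop :=
  [/\ (0 < d)%N, separating_degree d &
      forall e, (0 < e)%N -> separating_degree e -> (d <= e)%N].

End Representation.

(* m is the maximum of beta_sep(G, V) over all V: every V has a beta_sep, it is
   at most m, and m is attained. *)
Definition is_sep_noether_number (m : nat) : Prop :=
  (forall n (rG : mx_representation F G n),
     exists2 d, is_beta_sep rG d & (d <= m)%N) /\
  (exists n (rG : mx_representation F G n), is_beta_sep rG m).

Lemma is_beta_sep_inj n (rG : mx_representation F G n) d e :
  is_beta_sep rG d -> is_beta_sep rG e -> d = e.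
Proof.
move=> [d0 sd mind] [e0 se mine].
by apply/eqP; rewrite eqn_leq mind // mine.
Qed.

Lemma is_sep_noether_number_inj m k :
  is_sep_noether_number m -> is_sep_noether_number k -> m = k.
Proof.
move=> [lem [n [rG bm]]] [lek [n' [rG' bk]]]; apply/eqP; rewrite eqn_leq.
have [d /(is_beta_sep_inj bm) <- ->] := lek _ rG.
by have [d' /(is_beta_sep_inj bk) <- ->] := lem _ rG'.
Qed.

End SeparatingNoetherNumber.

(* Main.v *)
Require Import Defs.
From mathcomp Require Import all_boot all_order all_algebra all_fingroup.
From mathcomp Require Import reals.
From mathcomp Require Import all_character classical_sets boolp complex.
From mathcomp Require Import mpoly ring.

Set Implicit Arguments.
Unset Strict Implicit.
Unset Printing Implicit Defensive.

Import GRing.Theory Num.Theory.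
Local Open Scope ring_scope.

(* Upper bound. Averaging products of at most three affine forms over the group
   shows that, if no invariant of degree at most 3 separates [v] from [w], then
   the coordinates of [g |-> g v] and [g |-> g w], as families of functions on
   F_3^2, have the same triple correlations. On the Fourier side,
   x_c x_d x_e = y_c y_d y_e (for all choices of coordinates) as soon as
   c + d + e = 0. Taking c = d = e gives y_c = z^(k c) x_c with z a primitive
   cube root of unity. As x comes from real functions, its support S is stable
   under opposite, and on S the exponent k respects every relation
   c + d + e = 0; it is then the restriction to S of a linear form, which means
   that the two families differ by a translation, i.e. w lies in the orbit
   of v.
   Lower bound. For a rotation of order three of the plane, an invariant of
   degree at most 2 has no linear part, hence does not separate [v] from
   [- v]. *)

(** * Group sums of products of affine forms, and invariants of low degree *)

Section InvariantPolynomials.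
Variables (F : fieldType) (gT : finGroupType) (G : {group gT}) (n : nat).
Variable rG : mx_representation F G n.
Implicit Types (v w : 'cV[F]_n) (p : 'rV[F]_n * F).

(** Constant terms let products of three forms cover lower degrees too; [(0, 1)] is the constant
    1. *)
Definition affine_poly p : {mpoly F[n]} :=
  \sum_j p.1 ord0 j *: 'X_j + p.2%:MP_[n].

Definition affine_at p v : F := (p.1 *m v) ord0 ord0 + p.2.

Lemma poly_at_affine p v : poly_at (affine_poly p) v = affine_at p v.
Proof.
rewrite /poly_at mevalD mevalC raddf_sum /affine_at mxE /=; congr (_ + _).
by apply: eq_bigr => j _; rewrite mevalZ mevalXU.
Qed.

Lemma msize_affine p : (msize (affine_poly p) <= 2)%N.
Proof.
apply: leq_trans (msizeD_le _ _) _; rewrite geq_max; apply/andP; split.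
  apply: leq_trans (msize_sum _ _ _) _; apply/bigmax_leqP => j _.
  by apply: leq_trans (msizeZ_le _ _) _; rewrite msizeX mdeg1.
by rewrite msizeC; case: eqP.
Qed.

Lemma poly_act_affine g p :
  poly_act rG g (affine_poly p) = affine_poly (p.1 *m rG g^-1%g, p.2).
Proof.
rewrite /poly_act comp_mpolyD comp_mpolyC raddf_sum /=; congr (_ + _) => /=.
under eq_bigr => j _ do
  rewrite comp_mpolyZ comp_mpolyXU -tnth_nth tnth_mktuple scaler_sumr.
rewrite exchange_big /=; apply: eq_bigr => i _; rewrite mxE scaler_suml.
by apply: eq_bigr => j _; rewrite scalerA.
Qed.

Lemma msize_prod_affine (s : seq ('rV[F]_n * F)) :
  (msize (\prod_(p <- s) affine_poly p) <= (size s).+1)%N.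
Proof.
elim: s => [|p s IHs]; first by rewrite big_nil msize1.
rewrite big_cons /=; set q := \prod_(_ <- _) _ in IHs *.
have [->|pnz] := eqVneq (affine_poly p) 0; first by rewrite mul0r msize0.
have [->|qnz] := eqVneq q 0; first by rewrite mulr0 msize0.
rewrite msizeM // -subn1 leq_subLR.
exact: leq_add (msize_affine p) IHs.
Qed.

(** The group sum of such a product is the value of an invariant polynomial of degree at most
    [d]. *)
Lemma orbit_sum_affine d v w :
  (forall f, poly_invariant rG f -> (msize f <= d.+1)%N ->
     poly_at f v = poly_at f w) ->
  forall s : seq ('rV[F]_n * F), (size s <= d)%N ->
  \sum_(g in G) \prod_(p <- s) affine_at p (rG g *m v) =
  \sum_(g in G) \prod_(p <- s) affine_at p (rG g *m w).
Proof.
move=> fvw s les.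
pose f := \sum_(g in G) \prod_(p <- s) affine_poly (p.1 *m rG g, p.2).
have f_at u : poly_at f u =
    \sum_(g in G) \prod_(p <- s) affine_at p (rG g *m u).
  rewrite /poly_at /f raddf_sum; apply: eq_bigr => g _ /=.
  rewrite rmorph_prod; apply: eq_bigr => p _ /=.
  by have := poly_at_affine (p.1 *m rG g, p.2) u; rewrite /poly_at => ->;
    rewrite /affine_at /= mulmxA.
rewrite -!f_at; apply: fvw.
  move=> h hG; rewrite /poly_act /f raddf_sum /=.
  rewrite (reindex_inj (mulIg h)) /=.
  apply: eq_big => [g|g gG]; first by rewrite groupMr.
  rewrite rmorph_prod; apply: eq_bigr => p _ /=.
  have := poly_act_affine h (p.1 *m rG (g * h)%g, p.2).
  rewrite /poly_act => -> /=.
  by rewrite -mulmxA -repr_mxM ?groupV ?mulgK // -(groupMr _ hG).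
apply: leq_trans (msize_sum _ _ _) _; apply/bigmax_leqP => g gG.
rewrite -(big_map (fun p => (p.1 *m rG g, p.2)) predT affine_poly).
by apply: leq_trans (msize_prod_affine _) _; rewrite size_map.
Qed.

(* The odd part of [f] is linear, so its sum over the orbit of [v] vanishes. *)
Lemma quadratic_invariant_even f v :
  [pchar F] =i pred0 -> poly_invariant rG f -> (msize f <= 3)%N ->
  \sum_(g in G) rG g *m v = 0 -> poly_at f v = poly_at f (- v).
Proof.
move=> F0 inv_f szf sum0.
have inv_at g u : g \in G -> poly_at f (rG g *m u) = poly_at f u.
  by move=> gG; rewrite -{2}(inv_f g^-1%g) ?groupV // poly_actE invgK.
(* The group order is nonzero in [F], so one may sum over the group and treat each monomial
   separately. *)
have: (poly_at f v - poly_at f (- v)) *+ #|G| = 0.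
  rewrite -sumr_const.
  under eq_bigr => g gG do rewrite -(inv_at g v gG) -(inv_at g (- v) gG).
  rewrite /poly_at; under eq_bigr => g _ do rewrite !mevalE -sumrB.
  rewrite exchange_big /= big_seq big1 // => m m_f.
  under eq_bigr => g _ do rewrite -mulrBr.
  rewrite -mulr_sumr.
  have mN (u : 'cV[F]_n) : \prod_i (- u) i ord0 ^+ m i =
      (-1) ^+ mdeg m * \prod_i u i ord0 ^+ m i.
    rewrite mdegE -prodrXr -big_split /=; apply: eq_bigr => i _.
    by rewrite mxE (exprNn (u i ord0)).
  under eq_bigr => g _ do rewrite mulmxN mN.
  have lt_m := leq_trans (msize_mdeg_lt m_f) szf.
  (* Degree 1 gives twice a coordinate of the vanishing orbit sum; the other possible degrees, 0 and
     2, are even. *)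
  have [/eqP/mdeg1P [i /eqP ->] | m1] := eqVneq (mdeg m) 1%N.
    have prodU (u : 'cV[F]_n) : \prod_j u j ord0 ^+ U_(i)%MM j = u i ord0.
      rewrite (bigD1 i) //= mnm1E eqxx big1 ?mulr1 // => j ji.
      by rewrite mnm1E eq_sym (negPf ji).
    under eq_bigr => g _ do rewrite mdeg1 expr1 mulN1r opprK !prodU.
    by rewrite big_split /= -!summxE sum0 mxE addr0 mulr0.
  rewrite big1 ?mulr0 // => g _.
  by case: (mdeg m) lt_m m1 => [|[|[|k]]] //; rewrite ?expr0 ?sqrrN ?expr1n;
    rewrite mul1r subrr.
rewrite -mulr_natr => /eqP; rewrite mulf_eq0 => /orP [|].
  by rewrite subr_eq0 => /eqP.
by rewrite (pcharf0P _).1 // -leqn0 leqNgt cardG_gt0.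
Qed.

End InvariantPolynomials.

(** * Fourier analysis on F_3^2 *)

Section Fourier.
Variables (K : numClosedFieldType) (w : K).
Hypothesis w_prim : 3.-primitive_root w.
Local Notation G := ('Z_3 * 'Z_3)%type.
Implicit Types (c d g h : G) (a : G -> K).

Definition dot c g : 'Z_3 := c.1 * g.1 + c.2 * g.2.
Definition chi c g : K := w ^+ dot c g.
Definition fourier a c : K := \sum_g chi c g * a g.

Lemma expr_Z3D (x y : 'Z_3) : w ^+ (x + y)%R = w ^+ x * w ^+ y.
Proof. by rewrite -exprD -(prim_expr_mod w_prim (_ + _)). Qed.

Lemma expr_Z3_eq1 (x : 'Z_3) : w ^+ x = 1 -> x = 0.
Proof.
move/eqP; rewrite -(prim_order_dvd w_prim) => dvd3x.
by case: x dvd3x => [[|[|[|]]] ltx] // _; apply: val_inj.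
Qed.

Lemma conj_expr_Z3 (x : 'Z_3) : (w ^+ x)^* = w ^+ (- x)%R.
Proof.
have w3 : w ^+ 3 = 1 by rewrite prim_expr_order.
have nw : `|w| = 1 by apply/eqP; rewrite
    -(pexpr_eq1 (n := 3)) // -normrX w3 normr1.
have: w ^+ x * (w ^+ x)^* = 1 by rewrite -normCK normrX nw !expr1n.
by move=> unit_mod; rewrite -[RHS]mulr1 -unit_mod mulrA -expr_Z3D addNr mul1r.
Qed.

Lemma dotC c g : dot c g = dot g c.
Proof. by rewrite /dot mulrC [c.2 * _]mulrC. Qed.

Lemma dotDr c g h : dot c (g + h) = dot c g + dot c h.
Proof. by rewrite /dot /=; ring. Qed.

Lemma dotNr c g : dot c (- g) = - dot c g.
Proof. by rewrite /dot /=; ring. Qed.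

(** As -1 is not a square modulo 3, the form x^2 + y^2 is anisotropic. *)
Lemma dot_self_eq0 g : dot g g = 0 -> g = 0.
Proof.
case: g => x y /eqP; case: x => [[|[|[|]]] lx] //;
  case: y => [[|[|[|]]] ly] // _.
by congr pair; apply: val_inj.
Qed.

Lemma chiDr c g h : chi c (g + h) = chi c g * chi c h.
Proof. by rewrite /chi dotDr expr_Z3D. Qed.

Lemma chi_sum3 c1 c2 c3 g :
  c1 + c2 + c3 = 0 -> chi c1 g * chi c2 g * chi c3 g = 1.
Proof.
move=> sum0; rewrite /chi !(dotC _ g) -!expr_Z3D -!dotDr sum0.
by rewrite /dot !mulr0 addr0.
Qed.

(** Translating [c] by [g] itself multiplies the sum by [w ^+ dot g g], which is not 1 by
    anisotropy. *)
Lemma sum_chi g : g != 0 -> \sum_c chi c g = 0.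
Proof.
move=> gnz; apply/eqP/contraT => Snz; case/eqP: gnz; apply: dot_self_eq0.
apply: expr_Z3_eq1; apply: (mulfI Snz); rewrite mulr1.
rewrite [in RHS](reindex_inj (addIr g)) /= mulr_suml; apply: eq_bigr => c _.
by rewrite /chi dotC [in RHS]dotC dotDr expr_Z3D.
Qed.

(** Fourier inversion at the origin; other points are reached through [fourier_shift]. *)
Lemma fourier_inj_at0 a b : fourier a =1 fourier b -> a 0 = b 0.
Proof.
have inv a' : \sum_c fourier a' c = a' 0 *+ #|{: G}|.
  rewrite exchange_big /= (bigD1 (0 : G)) //= addrC big1 ?add0r.
    rewrite -sumr_const; apply: eq_bigr => c _.
    by rewrite /chi /dot !mulr0 addr0 mul1r.
  by move=> g gnz; rewrite -mulr_suml sum_chi // mul0r.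
move=> eq_ab; have := inv a; rewrite (eq_bigr _ (fun c _ => eq_ab c)) inv.
by move/eqP; rewrite eqr_pMn2r ?card_prod ?card_ord // => /eqP.
Qed.

Lemma fourier_shift a h c :
  fourier (fun g => a (g - h)) c = chi c h * fourier a c.
Proof.
rewrite /fourier (reindex_inj (addIr h)) /= mulr_sumr; apply: eq_bigr => g _.
by rewrite addrK chiDr mulrA [chi c g * _]mulrC.
Qed.

Lemma fourier_conj a c :
  (forall g, a g \is Num.real) -> (fourier a c)^* = fourier a (- c).
Proof.
move=> ra; rewrite /fourier raddf_sum; apply: eq_bigr => g _ /=.
by rewrite rmorphM /= (conj_Creal (ra g)) /chi conj_expr_Z3 (dotC (- c)) dotNr
  (dotC g).
Qed.

(** Take [g], [g + h], [g + l] as the three variables: the character factors depending on [g]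
    multiply to 1, leaving the Fourier transform of the triple correlation. *)
Lemma fourier_triple_product a1 a2 a3 c1 c2 c3 : c1 + c2 + c3 = 0 ->
  fourier a1 c1 * fourier a2 c2 * fourier a3 c3 =
  \sum_h \sum_l chi c2 h * chi c3 l * \sum_g a1 g * a2 (g + h) * a3 (g + l).
Proof.
move=> sum0.
under eq_bigr => h _ do under eq_bigr => l _ do rewrite mulr_sumr.
under eq_bigr => h _ do rewrite exchange_big /=.
rewrite exchange_big /= /fourier -mulrA mulr_suml; apply: eq_bigr => g _.
rewrite (reindex_inj (addrI g)) /= mulr_suml mulr_sumr; apply: eq_bigr => h _.
rewrite (reindex_inj (addrI g)) /= !mulr_sumr; apply: eq_bigr => l _.
rewrite -[RHS]mul1r -(chi_sum3 g sum0) !chiDr; ring.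
Qed.

Lemma sqr_Z3 (x : 'Z_3) : x != 0 -> x * x = 1.
Proof. by case: x => [[|[|[|]]] lx] // _; apply: val_inj. Qed.

(* If [c] and [d] in [S] are independent, then any [e] is [x c + y d] where
   [x c] and [y d] are again in [S], because x, y are 0, 1 or -1. *)
Lemma linear_on_symmetric (S : G -> Prop) (k : G -> 'Z_3) :
  S 0 -> k 0 = 0 -> (forall c, S c -> S (- c)) ->
  (forall c1 c2 c3, S c1 -> S c2 -> S c3 -> c1 + c2 + c3 = 0 ->
     k c1 + k c2 + k c3 = 0) ->
  exists h, forall c, S c -> k c = dot c h.
Proof.
move=> S0 k0 SN k3.
have kN c : S c -> k (- c) = - k c.
  move=> Sc; have := k3 _ _ _ Sc (SN _ Sc) S0.
  rewrite subrr addr0 k0 => /(_ erefl).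
  by rewrite addr0 addrC => /eqP; rewrite addr_eq0 => /eqP.
have kD c d : S c -> S d -> S (c + d) -> k (c + d) = k c + k d.
  move=> Sc Sd Scd; have := k3 _ _ _ Sc Sd (SN _ Scd).
  by rewrite subrr kN // => /(_ erefl)/eqP; rewrite subr_eq0 => /eqP ->.
pose scale (x : 'Z_3) (c : G) : G := (x * c.1, x * c.2).
have kZ x c : S c -> S (scale x c) /\ k (scale x c) = x * k c.
  move=> Sc; have: [\/ x = 0, x = 1 | x = -1].
    by case: x => [[|[|[|]]] lx] //;
      [constructor 1|constructor 2|constructor 3];
      apply: val_inj.
  case: c Sc => c1 c2 Sc; case=> ->; rewrite /scale /= ?mul0r ?mul1r ?mulN1r //.
  by split; [exact: (SN (c1, c2)) | exact: (kN (c1, c2))].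
pose det (c d : G) := c.1 * d.2 - c.2 * d.1.
have [[c [d [Sc Sd Dnz]]]|nodet] :=
    pselect (exists c d, [/\ S c, S d & det c d != 0]).
  have D2 := sqr_Z3 Dnz.
  (* Cramer's rule for [dot c h = k c] and [dot d h = k d]; the determinant is its own inverse. *)
  exists (det c d * (k c * d.2 - c.2 * k d), det c d * (c.1 * k d - k c * d.1)).
  move=> e Se; set x := det c d * det e d; set y := det c d * det c e.
  have eE : e = scale x c + scale y d.
    rewrite [LHS]surjective_pairing -[e.1]mul1r -[e.2]mul1r -D2 /x /y /det.
    by congr pair => /=; ring.
  have [Sx kx] := kZ x c Sc; have [Sy ky] := kZ y d Sd.
  rewrite {1}eE kD -?eE // kx ky /x /y /dot /det /=; ring.
(* Without an independent pair, [S] lies on the line of some nonzero [c], or is reduced to 0. *)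
have [[c [Sc cnz]]|noc] := pselect (exists c, S c /\ c != 0); last first.
  exists 0 => c Sc; rewrite /dot !mulr0 addr0.
  by have [-> //|cnz] := eqVneq c 0; case: noc; exists c.
have N2 : dot c c * dot c c = 1.
  by apply: sqr_Z3; apply: contra_neq cnz; apply: dot_self_eq0.
exists (scale (dot c c * k c) c) => e Se.
have D0 : det c e = 0.
  by apply/eqP/contraT => Dnz; case: nodet; exists c, e.
have eE : e = scale (dot c c * dot c e) c.
  rewrite [LHS]surjective_pairing -[e.1]mul1r -[e.2]mul1r -N2.
  (* The two sides differ by a multiple of [det c e], which is 0; adding it leaves a ring
     identity. *)
  congr pair; rewrite -[RHS]addr0.
    by rewrite -(mulr0 (- (dot c c * c.2))) -D0 /det /dot /=; ring.
  by rewrite -(mulr0 (dot c c * c.1)) -D0 /det /dot /=; ring.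
have [_ kc] := kZ (dot c c * dot c e) c Sc.
rewrite {1}eE kc.
have -> : dot e (scale (dot c c * k c) c) = dot c c * k c * dot c e.
  by rewrite /dot /=; ring.
by rewrite -!mulrA [dot c e * _]mulrC.
Qed.

(** The constant function at [i0] puts 0 in the support and gives [k 0 = 0]; real values make the
    support symmetric. Then [linear_on_symmetric] applies to the phases. *)
Lemma triple_correlation (I : Type) (a b : I -> G -> K) (i0 : I) :
  (forall i g, a i g \is Num.real) ->
  (forall g, a i0 g = 1) -> (forall g, b i0 g = 1) ->
  (forall i1 i2 i3 h l,
     \sum_g a i1 g * a i2 (g + h) * a i3 (g + l) =
     \sum_g b i1 g * b i2 (g + h) * b i3 (g + l)) ->
  exists h, forall i, b i 0 = a i h.
Proof.
move=> ra a1 b1 eq_ab.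
pose x i c := fourier (a i) c; pose y i c := fourier (b i) c.
have xy3 i1 i2 i3 c1 c2 c3 : c1 + c2 + c3 = 0 ->
    x i1 c1 * x i2 c2 * x i3 c3 = y i1 c1 * y i2 c2 * y i3 c3.
  move=> sum0; rewrite /x /y !fourier_triple_product //.
  by apply: eq_bigr => h _; apply: eq_bigr => l _; rewrite eq_ab.
have c3 c : c + c + c = 0.
  have x3 (t : 'Z_3) : t + t + t = 0.
    by case: t => [[|[|[|]]] lt3] //; apply: val_inj.
  by case: c => c1 c2; congr pair; apply: x3.
(* If [x i c] is nonzero, comparing cubes gives the phase at [i], and the triple [i, i, j] carries
   it over to every [j]. If all [x i c] vanish, so do all [y i c]. *)
have phase c : exists k : 'Z_3, forall i, y i c = w ^+ k * x i c.
  have [[i xnz]|x0] := pselect (exists i, x i c != 0).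
    have u3 : (y i c / x i c) ^+ 3 = 1.
      rewrite expr_div_n !exprS expr0 !mulr1 !mulrA -(xy3 i i i) //.
      by rewrite divff // !mulf_neq0.
    have [k uE] := prim_rootP w_prim u3; exists k => j.
    have yE : y i c = w ^+ k * x i c by rewrite -uE divfK.
    have w3 : w ^+ k * w ^+ k * w ^+ k = 1.
      by rewrite -!expr2 -exprSr -exprM mulnC exprM
        (prim_expr_order w_prim) expr1n.
    have wnz : w ^+ k != 0.
      by apply: contra_eq_neq w3 => ->; rewrite mulr0 eq_sym oner_eq0.
    apply: (mulfI (mulf_neq0 (mulf_neq0 wnz xnz) (mulf_neq0 wnz xnz))).
    rewrite -yE -(xy3 i i j) // yE.
    by rewrite -[LHS]mul1r -w3; ring.
  exists 0 => i; rewrite mul1r.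
  have xi0 : x i c = 0 by apply/eqP/contraT => xnz; case: x0; exists i.
  apply/eqP; have := xy3 i i i c c c (c3 c); rewrite xi0 !mul0r => /esym/eqP.
  by rewrite !mulf_eq0 !orbb.
have [k kE] := choice phase.
pose S c := exists i, x i c != 0.
have x1 : x i0 0 != 0.
  rewrite /x /fourier; under eq_bigr => g _ do
    rewrite a1 mulr1 /chi dotC /dot !mulr0 addr0.
  by rewrite sumr_const card_prod !card_ord pnatr_eq0.
have [h hE] : exists h, forall c, S c -> k c = dot c h.
  apply: linear_on_symmetric.
  - by exists i0.
  - apply: expr_Z3_eq1; apply: (mulIf x1); rewrite -kE mul1r /x /y /fourier.
    by apply: eq_bigr => g _; rewrite a1 b1.
  - by move=> c [i xnz]; exists i; rewrite /x -fourier_conj // conjC_eq0.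
  move=> c1 c2 c4 [i1 nz1] [i2 nz2] [i3 nz3] sum0; apply: expr_Z3_eq1.
  apply: (mulIf (mulf_neq0 (mulf_neq0 nz1 nz2) nz3)).
  by rewrite mul1r [RHS](xy3 _ _ _ _ _ _ sum0) !kE !expr_Z3D; ring.
(* The phases are now the character values at [h], so [b i] and the translate of [a i] by [h] have
   equal transforms. *)
exists (- h) => i; rewrite -[- h]add0r.
apply: (fourier_inj_at0 (b := fun g => a i (g - h))) => c.
rewrite fourier_shift -/(y i c) -/(x i c) kE.
have [->|xnz] := eqVneq (x i c) 0; first by rewrite !mulr0.
by rewrite hE //; exists i.
Qed.

End Fourier.

Lemma prim_root3_exists (K : numClosedFieldType) :
  exists w : K, 3.-primitive_root w.
Proof.
have [|w] := @closed_rootP K ('X^2 + 'X + 1) _.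
  by rewrite size_polyDl ?size_poly1 // size_polyDl ?size_polyXn ?size_polyX.
rewrite /root !hornerE => /eqP wE; exists w.
have w3 : w ^+ 3 = 1.
  by apply/eqP; rewrite -subr_eq0; apply/eqP;
    transitivity ((w - 1) * (w ^+ 2 + w + 1)); [ring | rewrite wE mulr0].
have [m mw m3] := prim_order_exists (isT : (0 < 3)%N) w3.
have /primeP [_ /(_ m m3) /orP [] /eqP mE] : prime 3 by []; last by rewrite -mE.
move: mw wE; rewrite mE => /prim_expr_order; rewrite expr1 => -> /eqP.
by rewrite expr1n -(natrD _ 1 1) -(natrD _ 2 1) pnatr_eq0.
Qed.

(** * Real representations of C_3 x C_3: the upper bound *)

Section RealRepresentations.
Variable R : realType.
Local Notation G := [set: 'Z_3 * 'Z_3]%G.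

Lemma separating_degree_leq n (rG : mx_representation R G n) d e :
  (d <= e)%N -> separating_degree rG d -> separating_degree rG e.
Proof.
move=> le_de sepd v w /sepd [f [inv_f szf fvw]]; exists f; split=> //.
exact: leq_trans szf _.
Qed.

Lemma separating_degree3 n (rG : mx_representation R G n) :
  separating_degree rG 3.
Proof.
move=> v w neq_vw; apply: contrapT => nosep; apply: neq_vw.
have eq_at f : poly_invariant rG f -> (msize f <= 4)%N ->
    poly_at f v = poly_at f w.
  by move=> inv_f szf; apply: contrapT => fvw; apply: nosep; exists f.
have sums := orbit_sum_affine eq_at.
have [z z_prim] := prim_root3_exists R[i].
(* The family is indexed by all affine forms. Translating [g] only changes the form, so triple
   correlations are group sums of the kind treated by [sums]. *)
pose a u (p : 'rV[R]_n * R) (g : 'Z_3 * 'Z_3) : R[i] :=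
  (affine_at p (rG g *m u))%:C%C.
have a1 u g : a u (0, 1) g = 1.
  by rewrite /a /affine_at mul0mx mxE add0r.
have aD u p g h : a u p (g + h) = a u (p.1 *m rG h, p.2) g.
  rewrite /a /affine_at /= !mulmxA -(mulmxA p.1 (rG h)) -repr_mxM ?inE //.
  by congr (((p.1 *m rG _ *m u) _ _ + _)%:C)%C; apply: addrC.
have [] := @triple_correlation _ _ z_prim _ (a v) (a w) (0, 1).
- by move=> p g; apply/complex_realP; eexists.
- exact: a1.
- exact: a1.
- move=> p1 p2 p3 h l.
  have prodE u : \sum_g a u p1 g * a u p2 (g + h) * a u p3 (g + l) =
      (\sum_(g in G) \prod_(p <- [:: p1; (p2.1 *m rG h, p2.2);
        (p3.1 *m rG l, p3.2)]) affine_at p (rG g *m u))%:C%C.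
    rewrite raddf_sum; apply: eq_big => [g|g _]; first by rewrite inE.
    by rewrite !aD /a !big_cons big_nil mulr1 /= !rmorphM mulrA.
  by rewrite !prodE sums.
move=> h eq_h.
have wE : w = rG h *m v.
  have r0 : rG 0 = 1%:M by exact: (repr_mx1 rG).
  apply/matrixP => i j; rewrite ord1.
  have := eq_h (delta_mx ord0 i, 0).
  by rewrite /a /affine_at r0 mul1mx !addr0 -!rowE !mxE => /complexI.
apply/seteqP; split=> u [g _ <-].
  exists (g * h^-1)%g; first by rewrite /= inE.
  by rewrite wE mulmxA -repr_mxM ?inE // mulgKV.
exists (g * h)%g; first by rewrite /= inE.
by rewrite wE mulmxA -repr_mxM ?inE.
Qed.

Lemma is_beta_sep_exists n (rG : mx_representation R G n) :
  exists2 d, is_beta_sep rG d & (d <= 3)%N.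
Proof.
pose P d := (0 < d)%N && `[< separating_degree rG d >].
have P3 : P 3 by apply/asboolP; apply: separating_degree3.
have [d /andP [d0 /asboolP sepd] mind] := ex_minnP (ex_intro P 3 P3).
exists d; last exact: mind.
by split=> // e e0 sepe; apply: mind; rewrite /P e0; apply/asboolP.
Qed.

(** * The lower bound: a plane rotation of order three *)

(* The companion matrix of X^2 + X + 1: [[0, -1], [1, -1]]. *)
Definition rot3 : 'M[R]_2 :=
  \matrix_(i, j) if (i == 0) then - (j == 1)%:R else (-1) ^+ j.

Lemma rot3_sum : 1 + rot3 + rot3 ^+ 2 = 0.
Proof.
apply/matrixP => i j; rewrite expr2 !mxE !big_ord_recl big_ord0 !mxE /=.
by case: i => [[|[|[]]] li] //; case: j => [[|[|[]]] lj] //=; ring.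
Qed.

Lemma rot3_cube : rot3 ^+ 3 = 1.
Proof.
apply/eqP; rewrite -subr_eq0 subrX1 !big_ord_recr big_ord0 /= add0r expr0 expr1.
by rewrite rot3_sum mulr0.
Qed.

Lemma rot3_repr : mx_repr G (fun g : 'Z_3 * 'Z_3 => rot3 ^+ g.1).
Proof.
split=> // g h _ _ /=; rewrite -[RHS]exprD.
rewrite [in RHS](divn_eq (g.1 + h.1) 3) exprD mulnC exprM rot3_cube expr1n.
by rewrite mul1r.
Qed.

Definition rot3_rep := MxRepresentation rot3_repr.

Lemma rot3_not_separating2 : ~ separating_degree rot3_rep 2.
Proof.
pose v : 'cV[R]_2 := delta_mx 0 0.
move=> /(_ v (- v)) [].
  move=> eq_orb; have: rep_orbit rot3_rep v v.
    by exists 1%g => //=; rewrite expr0 mul1mx.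
  rewrite eq_orb => -[g _ /= eq_g].
  have {eq_g} col0 i : - (rot3 ^+ g.1) i 0 = (i == 0)%:R.
    move/matrixP/(_ i 0): eq_g.
    by rewrite mulmxN -colE !mxE eqxx andbT.
  (* The powers of [rot3] have first columns (1, 0), (0, 1) and (-1, -1), none equal to (-1, 0). *)
  move: (col0 0) (col0 1); case: g.1 => [[|[|[|]]] lk] //=.
  - rewrite expr0 !mxE /= => /eqP.
    by rewrite eq_sym -addr_eq0 -(natrD _ 1 1) pnatr_eq0.
  - by rewrite expr1 !mxE /= !oppr0 => /eqP; rewrite eq_sym oner_eq0.
  rewrite expr2 !mxE !big_ord_recl !big_ord0 !mxE /= /bump => _.
  rewrite oppr0 !mulr0 add0r addr0 expr0 mulr1 expr1 opprK => /eqP.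
  by rewrite oner_eq0.
move=> f [inv_f szf]; apply; apply: quadratic_invariant_even inv_f szf _.
  exact: pchar_num.
(* For each fixed second coordinate, the group sum of matrices is 1 + [rot3] + [rot3 ^+ 2] = 0. *)
rewrite -mulmx_suml.
under eq_bigl => g do rewrite inE.
rewrite -(pair_bigA _ (fun (x y : 'Z_3) => rot3 ^+ x)) exchange_big /=.
rewrite big1 ?mul0mx //.
by move=> y _; rewrite !big_ord_recr big_ord0 /= add0r expr0 expr1 rot3_sum.
Qed.

End RealRepresentations.

Theorem proposition5p8 (R : realType) :
  is_sep_noether_number R [set: 'Z_3 * 'Z_3]%G 3.
Proof.
split; first exact: is_beta_sep_exists.
exists 2%N, (rot3_rep R); split=> //; first exact: separating_degree3.
move=> e _ sepe; rewrite leqNgt; apply/negP => lt_e3.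
exact: (@rot3_not_separating2 R) (separating_degree_leq _ sepe).
Qed.
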